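(* Let $Q$ be a set of snapshots. Let $S_1\subseteq\mathrm{dom}(Q)$ be the set of actors $B$ for which there is a refob $x: A\to B$ with $Q\vdash\mathrm{Chain}(x)$ and $Q\not\vdash\mathrm{Relevant}(x)$; let $S_2\subseteq\mathrm{dom}(Q)$ be the set of actors in $\mathrm{dom}(Q)$ that depend in $Q$ on some actor of $S_1$; and let $S_3=\mathrm{dom}(Q)\setminus S_2$. Then the restriction of $Q$ to $S_3$ is the largest finalized subset of $Q$: it is finalized, and the domain of every finalized subset of $Q$ is contained in $S_3$.
   Context: A refob is a triple $(x,A,B)$ of a token $x$, owner actor $A$ and target actor $B$, written $x: A\to B$. A fact is one of $\mathrm{Created}(x)$, $\mathrm{Released}(x)$, $\mathrm{CreatedUsing}(x,y)$, $\mathrm{Activated}(x)$, $\mathrm{Unreleased}(x)$, $\mathrm{SentCount}(x,n)$, $\mathrm{RecvCount}(x,n)$ ($n\in\mathbb N$). A knowledge set $\Phi$ is a finite set of facts; $\Phi\vdash\varphi$ means $\varphi$ is derivable from $\Phi$ in first-order logic plus the rules: if no $\mathrm{SentCount}(x,n)\in\Phi$ then $\Phi\vdash\mathrm{SentCount}(x,0)$; if no $\mathrm{RecvCount}(x,n)\in\Phi$ then $\Phi\vdash\mathrm{RecvCount}(x,0)$; if $\Phi\vdash\mathrm{Created}(x)$ and $\Phi\not\vdash\mathrm{Released}(x)$ then $\Phi\vdash\mathrm{Unreleased}(x)$; if $\Phi\vdash\mathrm{CreatedUsing}(x,y)$ then $\Phi\vdash\mathrm{Created}(y)$. A set of snapshots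 $Q$ is a finite partial map from actors to knowledge sets; a subset of $Q$ is a restriction of $Q$ to a subset of $\mathrm{dom}(Q)$. For a refob $x:A\to B$: $Q\vdash\mathrm{Activated}(x)$, $Q\vdash\mathrm{SentCount}(x,n)$, $Q\vdash\mathrm{CreatedUsing}(x,y)$ mean $A\in\mathrm{dom}(Q)$ and $Q(A)$ derives the fact; $Q\vdash\mathrm{Created}(x)$, $Q\vdash\mathrm{Released}(x)$, $Q\vdash\mathrm{RecvCount}(x,n)$ mean $B\in\mathrm{dom}(Q)$ and $Q(B)$ derives the fact. $Q\vdash\mathrm{Chain}(x:A\to B)$ iff there are refobs $x_1:A_1\to B,\dots,x_n:A_n\to B$ with $Q\vdash\mathrm{Created}(x_1)$, $Q\not\vdash\mathrm{Released}(x_1)$, for all $i<n$ $Q\vdash\mathrm{CreatedUsing}(x_i,x_{i+1})$ and $Q\not\vdash\mathrm{Released}(x_{i+1})$, and $A_n=A$, $x_n=x$. $Q\vdash\mathrm{Relevant}(x)$ iff for some $n$, $Q\vdash\mathrm{Activated}(x)$, $Q\vdash\mathrm{SentCount}(x,n)$ and $Q\vdash\mathrm{RecvCount}(x,n)$. $Q$ is finalized if for all $B\in\mathrm{dom}(Q)$ and all refobs $x:A\to B$, $Q\vdash\mathrm{Chain}(x)$ implies $A\in\mathrm{dom}(Q)$ and $Q\vdash\mathrm{Relevant}(x)$. $B$ depends on $A$ in $Q$ if $A=B$ or there is a sequence of refobs $x_1:A_1\to A_2,\dots,x_{n-1}:A_{n-1}\to A_n$ ($n\ge2$) with $A_1=A$,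 $A_n=B$ and $Q\vdash\mathrm{Chain}(x_i)$ for each $i<n$. *)

(* Defs.v *)
From HB Require Import structures.
From mathcomp Require Import all_boot finmap boolp.

Set Implicit Arguments.
Unset Strict Implicit.
Unset Printing Implicit Defensive.

Local Open Scope fset_scope.
Local Open Scope fmap_scope.

Definition refob (token actor : choiceType) : Type :=
  (token * actor * actor)%type.

HB.instance Definition _ (token actor : choiceType) :=
  Choice.on (refob token actor).

Definition owner (token actor : choiceType) (x : refob token actor) : actor :=
  x.1.2.

Definition target (token actor : choiceType) (x : refob token actor) : actor :=
  x.2.

(* Facts are the case [fact_over refob nat]; the atomic formulas of the logic
   below are the same predicates applied to first-order terms. *)
Inductive fact_over (R N : Type) : Type :=
| Created (x : R)
| Released (x : R)
| CreatedUsing (x y : R)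
| Activated (x : R)
| Unreleased (x : R)
| SentCount (x : R) (n : N)
| RecvCount (x : R) (n : N).

Arguments Created {R N}.
Arguments Released {R N}.
Arguments CreatedUsing {R N}.
Arguments Activated {R N}.
Arguments Unreleased {R N}.
Arguments SentCount {R N}.
Arguments RecvCount {R N}.

Definition fact_map (R N R' N' : Type) (f : R -> R') (g : N -> N')
    (p : fact_over R N) : fact_over R' N' :=
  match p with
  | Created x => Created (f x)
  | Released x => Released (f x)
  | CreatedUsing x y => CreatedUsing (f x) (f y)
  | Activated x => Activated (f x)
  | Unreleased x => Unreleased (f x)
  | SentCount x n => SentCount (f x) (g n)
  | RecvCount x n => RecvCount (f x) (g n)
  end.

Section FactChoice.
Variables R N : choiceType.

Definition fact_code (p : fact_over R N) :
    (R + R + R + R + R * R + R * N + R * N)%type :=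
  match p with
  | Created x => inl (inl (inl (inl (inl (inl x)))))
  | Released x => inl (inl (inl (inl (inl (inr x)))))
  | Activated x => inl (inl (inl (inl (inr x))))
  | Unreleased x => inl (inl (inl (inr x)))
  | CreatedUsing x y => inl (inl (inr (x, y)))
  | SentCount x n => inl (inr (x, n))
  | RecvCount x n => inr (x, n)
  end.

Definition fact_decode (c : (R + R + R + R + R * R + R * N + R * N)%type) :
    fact_over R N :=
  match c with
  | inl (inl (inl (inl (inl (inl x))))) => Created x
  | inl (inl (inl (inl (inl (inr x))))) => Released x
  | inl (inl (inl (inl (inr x)))) => Activated x
  | inl (inl (inl (inr x))) => Unreleased x
  | inl (inl (inr (x, y))) => CreatedUsing x y
  | inl (inr (x, n)) => SentCount x n
  | inr (x, n) => RecvCount x n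
  end.

Lemma fact_codeK : cancel fact_code fact_decode.
Proof. by case. Qed.

HB.instance Definition _ := Choice.copy (fact_over R N) (can_type fact_codeK).

End FactChoice.

Definition fact (token actor : choiceType) : Type :=
  fact_over (refob token actor) nat.

HB.instance Definition _ (token actor : choiceType) :=
  Choice.on (fact token actor).

Definition knowledge (token actor : choiceType) : Type :=
  {fset fact token actor}.

Section Logic.
Variables token actor : choiceType.
Local Notation refob := (refob token actor).
Local Notation fact := (fact token actor).
Local Notation knowledge := (knowledge token actor).

(* One-sorted classical first-order logic, with de Bruijn variables and with
   refobs and natural numbers as constants. The other connectives and the
   existential quantifier are classically definable from these. *)
Inductive term : Type :=
| Var of nat
| RefC of refob
| NatC of nat.

Inductive form : Type :=
| Atom of fact_over term term
| Bot
| Imp of form & form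
| All of form.

Definition scons (T : Type) (t : T) (s : nat -> T) (k : nat) : T :=
  if k is j.+1 then s j else t.

Definition term_subst (s : nat -> term) (t : term) : term :=
  if t is Var k then s k else t.

Definition shift (k : nat) : term := Var k.+1.

Fixpoint form_subst (s : nat -> term) (p : form) : form :=
  match p with
  | Atom a => Atom (fact_map (term_subst s) (term_subst s) a)
  | Bot => Bot
  | Imp p q => Imp (form_subst s p) (form_subst s q)
  | All p => All (form_subst (scons (Var 0) (term_subst shift \o s)) p)
  end.

Definition lit (p : fact) : form := Atom (fact_map RefC NatC p).

(* A Hilbert calculus for first-order logic, extended with the facts of [Phi]
   and the four rules for knowledge sets. The negative premise of the rule for
   [Unreleased] is abstracted as [U]. *)
Inductive prov (U : refob -> Prop) (Phi : knowledge) : form -> Prop :=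
| prov_K p q : prov U Phi (Imp p (Imp q p))
| prov_S p q r :
    prov U Phi (Imp (Imp p (Imp q r)) (Imp (Imp p q) (Imp p r)))
| prov_DNE p : prov U Phi (Imp (Imp (Imp p Bot) Bot) p)
| prov_inst p t : prov U Phi (Imp (All p) (form_subst (scons t Var) p))
| prov_dist p q : prov U Phi (Imp (All (Imp p q)) (Imp (All p) (All q)))
| prov_vac p : prov U Phi (Imp p (All (form_subst shift p)))
| prov_MP p q : prov U Phi (Imp p q) -> prov U Phi p -> prov U Phi q
| prov_gen p : prov U Phi p -> prov U Phi (All p)
| prov_mem f : f \in Phi -> prov U Phi (lit f)
| prov_SentCount x : (forall n, SentCount x n \notin Phi) ->
    prov U Phi (lit (SentCount x 0))
| prov_RecvCount x : (forall n, RecvCount x n \notin Phi) ->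
    prov U Phi (lit (RecvCount x 0))
| prov_Unreleased x : U x -> prov U Phi (lit (Created x)) ->
    prov U Phi (lit (Unreleased x))
| prov_CreatedUsing x y : prov U Phi (lit (CreatedUsing x y)) ->
    prov U Phi (lit (Created y)).

(* "If Phi |- Created(x) and Phi |/- Released(x) then Phi |- Unreleased(x)"
   refers negatively to the relation being defined. No rule concludes
   [Released], so it is read stratified: first derivability without that rule,
   then with it. By [derives_Unreleased] below, the rule holds as stated. *)
Definition derives (Phi : knowledge) (f : fact) : Prop :=
  prov (fun x => ~ prov (fun=> False) Phi (lit (Released x))) Phi (lit f).

Section Soundness.
Variable I : fact_over (refob + nat) (refob + nat) -> Prop.

Definition term_val (v : nat -> refob + nat) (t : term) : refob + nat :=
  match t with Var k => v k | RefC x => inl x | NatC n => inr n end.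

Fixpoint sat (v : nat -> refob + nat) (p : form) : Prop :=
  match p with
  | Atom a => I (fact_map (term_val v) (term_val v) a)
  | Bot => False
  | Imp p q => sat v p -> sat v q
  | All p => forall d, sat (scons d v) p
  end.

Lemma sat_subst p s v w : (forall k, term_val w (s k) = v k) ->
  sat w (form_subst s p) <-> sat v p.
Proof.
elim: p s v w => [a|//|p IHp q IHq|p IHp] s v w svw /=.
- have tE t : term_val w (term_subst s t) = term_val v t.
    by case: t => [k|x|n] //=.
  by case: a => *; rewrite /= !tE.
- by split=> pq /(IHp _ _ _ svw) /pq /(IHq _ _ _ svw).
- have svw' d k : term_val (scons d w)
      (scons (Var 0) (term_subst shift \o s) k) = scons d v k.
    by case: k => [//|k] /=; rewrite -svw; case: (s k).
  by split=> ps d; apply/(IHp _ _ _ (svw' d)); apply: ps.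
Qed.

End Soundness.

Lemma prov_Released U Phi x :
  prov U Phi (lit (Released x)) <-> Released x \in Phi.
Proof.
split=> [|xP]; last exact: prov_mem.
pose I (a : fact_over (refob + nat) (refob + nat)) :=
  if a is Released (inl y) then Released y \in Phi : Prop else
  if a is Released (inr _) then False else True.
suff sound p : prov U Phi p -> forall v, sat I v p.
  by move=> /sound /(_ (fun=> inr 0)).
elim=> {p}.
- by move=> p q v /=.
- by move=> p q r v /= pqr pq pv; apply: pqr => //; apply: pq.
- by move=> p v /=; apply: contrapT.
- move=> p t v /= pv; apply/(@sat_subst _ _ _ (scons (term_val v t) v)) => //.
  by case.
- by move=> p q v /= pq pv d; apply: pq.
- by move=> p v /= pv d; apply/(@sat_subst _ _ _ v).
- by move=> p q _ pq _ pv v; apply: pq (pv v).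
- by move=> p _ pv v /= d.
- by case.
- by [].
- by [].
- by [].
- by [].
Qed.

Lemma derives_Unreleased Phi x :
  derives Phi (Created x) -> ~ derives Phi (Released x) ->
  derives Phi (Unreleased x).
Proof.
move=> Cx nRx; apply: prov_Unreleased => //.
by move=> /prov_Released Rx; apply: nRx; apply/prov_Released.
Qed.

End Logic.

Definition snapshots (token actor : choiceType) : Type :=
  {fmap actor -> knowledge token actor}.

Section Snapshots.
Variables token actor : choiceType.
Implicit Types (Q : snapshots token actor) (A B : actor)
  (x y : refob token actor) (f : fact token actor).

Definition derives_at Q A f : Prop :=
  exists2 Phi, Q.[? A] = Some Phi & derives Phi f.

(* Each fact is looked up in the snapshot of its witness, owner or target.
   [Unreleased] has no witness: the judgment is not defined for it, and it is
   not used. *)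
Definition Qderives Q f : Prop :=
  match f with
  | Activated x | SentCount x _ | CreatedUsing x _ => derives_at Q (owner x) f
  | Created x | Released x | RecvCount x _ => derives_at Q (target x) f
  | Unreleased _ => False
  end.

(* The refobs of the chain are [c 0], ..., [c n]; other values are ignored. *)
Definition Chain Q x : Prop :=
  exists n (c : nat -> refob token actor),
    [/\ forall i, i <= n -> target (c i) = target x,
        Qderives Q (Created (c 0)) /\ ~ Qderives Q (Released (c 0)),
        forall i, i < n -> Qderives Q (CreatedUsing (c i) (c i.+1)) /\
                           ~ Qderives Q (Released (c i.+1))
      & c n = x].

Definition Relevant Q x : Prop :=
  exists n, [/\ Qderives Q (Activated x), Qderives Q (SentCount x n)
              & Qderives Q (RecvCount x n)].

Definition finalized Q : Prop :=
  forall B x, B \in domf Q -> target x = B -> Chain Q x ->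
    owner x \in domf Q /\ Relevant Q x.

(* [B] depends on [A] in [Q]; the sequence of refobs is [c 0], ..., [c m.-1]. *)
Definition depends Q B A : Prop :=
  A = B \/
  exists m (a : nat -> actor) (c : nat -> refob token actor),
    [/\ 0 < m, a 0 = A, a m = B
      & forall i, i < m ->
          [/\ owner (c i) = a i, target (c i) = a i.+1 & Chain Q (c i)]].

Definition subsnapshots Q' Q : Prop :=
  exists2 D : {fset actor}, D `<=` domf Q & Q' = Q.[& D].

End Snapshots.

(* Main.v *)
Require Import Defs.
From mathcomp Require Import all_boot finmap boolp.

Local Open Scope fset_scope.
Local Open Scope fmap_scope.

(** Restricting the snapshots to [D] can only lose chains, so the actors of
[S3] have no irrelevant incoming chain, and [S3] is closed under owners of
chains because dependency is transitive. Conversely, if the restriction to [D]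
is finalized, no chain with target in [D] is lost: following it from its first
refob, finalization puts the owner of each refob in [D], hence the fact
creating the next one is still derivable. So [D] is closed under dependencies
and contains no actor of [S1]. *)

Section Restriction.
Context {token actor : choiceType}.
Implicit Types (Q : snapshots token actor) (D : {fset actor}) (A B : actor)
  (x : refob token actor) (f : fact token actor).

Lemma derives_at_dom Q A f : derives_at Q A f -> A \in domf Q.
Proof. by case=> Phi; case: fndP. Qed.

Lemma derives_at_restrict Q D A f :
  derives_at Q.[& D] A f <-> A \in D /\ derives_at Q A f.
Proof.
rewrite /derives_at fnd_restrict; case: ifP => _; first by split=> [|[]].
by split=> [[]|[]].
Qed.

Lemma Qderives_restrictW {Q D f} : Qderives Q.[& D] f -> Qderives Q f.
Proof. by case: f => //= > /derives_at_restrict[]. Qed.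

Lemma Relevant_owner {Q x} : Relevant Q x -> owner x \in domf Q.
Proof. by case=> n [/= /derives_at_dom]. Qed.

Lemma Relevant_restrictW Q D x : Relevant Q.[& D] x -> Relevant Q x.
Proof.
by case=> n [Ax Sx Rx]; exists n; split; apply: (Qderives_restrictW (D := D)).
Qed.

Lemma Relevant_restrict Q D x :
  owner x \in D -> target x \in D -> Relevant Q x -> Relevant Q.[& D] x.
Proof.
by move=> AD BD [n [Ax Sx Rx]]; exists n; split; apply/derives_at_restrict.
Qed.

(** Restricting also loses [Released] facts, so the negative conditions need an argument: all refobs
    of a chain share one target, [Created (c 0)] puts it in [D], and on [D] both sets of snapshots
    agree. *)
Lemma Chain_restrictW Q D x : Chain Q.[& D] x -> Chain Q x.
Proof.
case=> n [c [tgt [C0 nR0] step cn]].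
have BD : target x \in D.
  by rewrite -(tgt 0 (leq0n n)); case/derives_at_restrict: C0.
have nR i : i <= n -> ~ Qderives Q.[& D] (Released (c i)) ->
    ~ Qderives Q (Released (c i)).
  by move=> /tgt ti nRi Ri; apply/nRi/derives_at_restrict; split=> //; rewrite ti.
exists n, c; split=> // [|i lt_in].
  by split; [apply: Qderives_restrictW C0 | apply: (nR _ (leq0n n) nR0)].
have [CU nRi] := step i lt_in.
by split; [apply: Qderives_restrictW CU | apply: (nR _ lt_in nRi)].
Qed.

Lemma finalized_Chain_restrict {Q D x} :
    D `<=` domf Q -> finalized Q.[& D] -> target x \in D -> Chain Q x ->
  Chain Q.[& D] x.
Proof.
move=> sDQ fin BD [n [c [tgt [C0 nR0] step <-]]].
have domD : domf Q.[& D] = D by rewrite domf_restrict; apply/fsetIidPl.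
(* Finalization speaks only of chains of the restriction, so each [c i] must be shown to end one
   before its owner can be placed in [D]. *)
suff H i : i <= n -> Chain Q.[& D] (c i) by apply: H.
elim: i => [_|i IHi lt_in].
  exists 0, c; split=> // [i|]; first by rewrite leqn0 => /eqP->.
  split; last by move/Qderives_restrictW.
  by apply/derives_at_restrict; split=> //; rewrite tgt.
have Ci := IHi (ltnW lt_in); have [m [d [dtgt d0 dstep dm]]] := Ci.
have [CU nR] := step i lt_in.
have tE : target (c i.+1) = target (c i) by rewrite !tgt // ltnW.
have OD : owner (c i) \in D.
  rewrite -domD; apply: (fin _ _ _ erefl (IHi (ltnW lt_in))).1.
  by rewrite domD tgt // ltnW.
(* The chain [d] obtained for [c i] ends with [d m = c i]. The refob [c i.+1] is appended at index
   [m.+1]; the new link, at [j = m], survives because [owner (c i)] is in [D]. *)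
exists m.+1, (fun j => if j <= m then d j else c i.+1); split=> /=.
- by move=> j _; case: ifP => // /dtgt; rewrite tE.
- exact: d0.
- move=> j; rewrite ltnS => le_jm; rewrite le_jm.
  case: ltngtP le_jm => // [lt_jm|->] _; first exact: dstep.
  rewrite dm; split; last by case/derives_at_restrict.
  exact/derives_at_restrict.
- by rewrite ltnn.
Qed.

Lemma depends_Chain Q A x :
  depends Q (owner x) A -> Chain Q x -> depends Q (target x) A.
Proof.
move=> dep Cx; right; case: dep => [->|[m [a [c [m_gt0 a0 am step]]]]].
  exists 1, (fun i => if i is 0 then owner x else target x), (fun=> x).
  by split=> // -[].
(* Here [a m = owner x], so [x] is appended as refob number [m], leading to [target x] at index
   [m.+1]. *)
exists m.+1, (fun i => if i <= m then a i else target x),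
  (fun i => if i < m then c i else x); split; rewrite ?ltnn // => i.
rewrite ltnS => le_im; rewrite le_im.
case: ltngtP le_im => // [lt_im|->] _; first exact: step.
by split.
Qed.

(** Induction from the last refob back to the first, moving [P] from target to owner. *)
Lemma depends_closed Q (P : actor -> Prop) A B :
    (forall x, Chain Q x -> P (target x) -> P (owner x)) ->
  depends Q B A -> P B -> P A.
Proof.
move=> closedP [->//|[m [a [c [_ <- <- step]]]]].
elim: m step => // m IHm step Pm.
apply: IHm => [i lt_im|]; first exact/step/ltnW.
by have [<- tE Cm] := step m (ltnSn m); apply: closedP; rewrite ?tE.
Qed.

End Restriction.

Theorem theorem7p7 (token actor : choiceType) (Q : snapshots token actor) :
  let S1 : {fset actor} :=
    [fset B in domf Q | `[< exists x : refob token actor,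
       [/\ target x = B, Chain Q x & ~ Relevant Q x] >]] in
  let S2 : {fset actor} :=
    [fset B in domf Q | `[< exists2 A : actor, A \in S1 & depends Q B A >]] in
  let S3 : {fset actor} := domf Q `\` S2 in
  [/\ subsnapshots Q.[& S3] Q,
      finalized Q.[& S3]
    & forall Q' : snapshots token actor,
        subsnapshots Q' Q -> finalized Q' -> domf Q' `<=` S3].
Proof.
move=> S1 S2 S3; have sS3 : S3 `<=` domf Q by apply: fsubsetDl.
split; first by exists S3.
- move=> B x; rewrite domf_restrict (fsetIidPl sS3).
  move=> BS3 tx /Chain_restrictW Cx.
  move: (BS3); rewrite inE => /andP[/negP nS2 BQ].
  have nS2dep A : A \in S1 -> ~ depends Q B A.
    by move=> AS1 dep; apply/nS2; rewrite !inE BQ; apply/asboolP; exists A.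
  (* Otherwise [x] puts [B] itself in [S1], and [B] depends on itself. *)
  have Rx : Relevant Q x.
    apply: contrapT => nRx; apply: (nS2dep B); last by left.
    by rewrite !inE BQ; apply/asboolP; exists x.
  suff AS3 : owner x \in S3 by split=> //; apply: Relevant_restrict; rewrite ?tx.
  (* If the owner depended on some [A] in [S1], appending [x] would make [B] depend on [A]. *)
  rewrite inE (Relevant_owner Rx) andbT; apply/negP.
  rewrite !inE => /andP[_ /asboolP[A AS1 dep]].
  by apply: (nS2dep A AS1); rewrite -tx; apply: depends_Chain.
- move=> Q' [D sDQ ->] fin.
  have domD : domf Q.[& D] = D by rewrite domf_restrict; apply/fsetIidPl.
  have finD x : Chain Q x -> target x \in D ->
      owner x \in D /\ Relevant Q x.
    move=> Cx BD; have Cx' := finalized_Chain_restrict sDQ fin BD Cx.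
    have [|] := fin _ x _ erefl Cx'; first by rewrite domD.
    by rewrite domD => AD /Relevant_restrictW.
  rewrite domD; apply/fsubsetP => B BD; rewrite inE (fsubsetP sDQ) // andbT.
  apply/negP; rewrite !inE => /andP[_ /asboolP[A AS1 dep]].
  (* By [finD], membership in [D] passes back along the dependency from [B] to [A]; at [A], [finD]
     contradicts the irrelevant refob that puts [A] in [S1]. *)
  have AD : A \in D.
    by apply: (depends_closed Q (fun A => A \in D)) dep BD => x /finD H /H[].
  move: AS1; rewrite !inE => /andP[_ /asboolP[x [tx Cx nRx]]].
  by apply: nRx; apply: (finD x Cx _).2; rewrite tx.
Qed.
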